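(* Let $\mathcal{P}_N=\{\boldsymbol{x}_0,\dots,\boldsymbol{x}_{N-1}\}\subset[0,1)^d$, $N=2^m$, be a digital net in base $2$ with generating matrices $C_1,\dots,C_d\in\mathbb{F}_2^{\mathbb{N}\times m}$. Let $p\ge1$, let $c_0,\dots,c_{2^p-1}\in[0,1]$ be the nodes of an equal-weight one-dimensional rule, let $u\subseteq\{1,\dots,d\}$ be a coordinate subset, and let $t_u$ be a valid $t$-value of the projected digital net on $u$. If $$p|u|\le m-t_u,$$ then $\operatorname{rank}(A_{p,u})=p|u|$. Consequently, the transformed rule reproduces the complete product cubature rule on $u$, i.e. $Q_{N,p}(f_u)=Q_{p,u}^{\mathrm{prod}}(f_u)$ for every function $f_u$ depending only on the coordinates in $u$.
   Context: Digital net in base $2$: generating matrices $C_1,\dots,C_d\in\mathbb{F}_2^{\mathbb{N}\times m}$ (infinitely many output rows, $m$ input columns) are given, so that each coordinate has an infinite binary expansion. For $0\le n<N=2^m$ with $n=n_0+2n_1+\cdots+2^{m-1}n_{m-1}$, $n_i\in\{0,1\}$, let $\vec n=(n_0,\dots,n_{m-1})^\top\in\mathbb{F}_2^m$, $\vec y_{n,j}=C_j\vec n=(y_{n,j,1},y_{n,j,2},\dots)^\top\in\mathbb{F}_2^{\mathbb{N}}$ and $x_{n,j}=\sum_{r\ge1}y_{n,j,r}2^{-r}$; the points are $\boldsymbol{x}_n=(x_{n,1},\dots,x_{n,d})\in[0,1)^d$, counted with multiplicity. An integer $0\le t_u\le m$ is a valid $t$-value of the projected digital net on $u$ if the projected multiset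 $\{(x_{n,j})_{j\in u}:0\le n<2^m\}\subset[0,1)^{u}$ is a $(t_u,m,|u|)$-net in base $2$: every elementary interval $\prod_{j\in u}\bigl[b_j2^{-e_j},(b_j+1)2^{-e_j}\bigr)$ with integers $e_j\ge0$, $0\le b_j<2^{e_j}$, and $\sum_{j\in u}e_j=m-t_u$ (volume $2^{t_u-m}$) contains exactly $2^{t_u}$ points. The linear map $A_p:\mathbb{F}_2^m\to(\mathbb{F}_2^p)^d$ sends the $m$ input bits of the digital net to the first $p$ output bits of each coordinate: $A_p(\vec n)=(C_{j,p}\vec n)_{j=1}^d$, where $C_{j,p}\in\mathbb{F}_2^{p\times m}$ consists of the first $p$ rows of $C_j$. Its coordinate projection onto $u$ is $A_{p,u}:\mathbb{F}_2^m\to(\mathbb{F}_2^p)^{|u|}$, $A_{p,u}(\vec n)=(C_{j,p}\vec n)_{j\in u}$. The one-dimensional rule is $Q_p^{(1)}(g)=2^{-p}\sum_{a=0}^{2^p-1}g(c_a)$, where the index $a$ is identified with a $p$-bit binary symbol. For $x\in[0,1)$, $I_p(x)=\lfloor2^px\rfloor$ and $T_p(x)=c_{I_p(x)}$; $T_p$ acts coordinate-wise on $[0,1)^d$, so the leading $p$ binary digits of each coordinate select one cubature node. The transformed rule is $Q_{N,p}(f)=\frac1N\sum_{n=0}^{N-1}f(T_p(\boldsymbol{x}_n))$. The complete product cubature rule on $u$ is the $|u|$-dimensional tensor product of the same one-dimensional rule: for $f_u$ depending only on the coordinates in $u$ (regarded as a function of those coordinates), $Q_{p,u}^{\mathrm{prod}}(f_u)=2^{-p|u|}\sum_{\boldsymbol{a}\in\{0,\dots,2^p-1\}^{u}}f_u\bigl((c_{a_j})_{j\in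 u}\bigr)$.
   Formalization: The rank claim is proved assuming no digit sequence y_{n,j}, j in u, ends in infinitely many 1s; without this it fails (m=d=p=1, C_1=(0,1,1,...)^T gives points 0, 1/2 but rank 0). The cubature identity is proved without this assumption. *)

(* Defs.v *)
From HB Require Import structures.
From mathcomp Require Import all_boot all_order all_algebra.
From mathcomp Require Import all_classical all_reals all_analysis.
Set Implicit Arguments.
Unset Strict Implicit.
Unset Printing Implicit Defensive.
Import Order.TTheory GRing.Theory Num.Theory.
Import numFieldNormedType.Exports.
Local Open Scope ring_scope.

(* The generating matrices are a family C : 'I_d -> nat -> 'I_m -> 'F_2, where
   C j r i is the entry of the j-th matrix in row r and column i.  Rows are
   numbered from 0, so row r produces the binary digit of weight 2^-(r+1). *)

Definition bits (m n : nat) : 'cV['F_2]_m :=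
  \col_(i < m) (odd (n %/ 2 ^ i))%:R.

Definition gen_block (m d : nat) (C : 'I_d -> nat -> 'I_m -> 'F_2)
    (p : nat) (j : 'I_d) : 'M['F_2]_(p, m) :=
  \matrix_(r < p, i < m) C j r i.

Definition digit (m d : nat) (C : 'I_d -> nat -> 'I_m -> 'F_2)
    (n : nat) (j : 'I_d) (r : nat) : 'F_2 :=
  \sum_(i < m) C j r i * bits m n i 0.

Definition coordinate (R : realType) (m d : nat)
    (C : 'I_d -> nat -> 'I_m -> 'F_2) (n : nat) (j : 'I_d) : R :=
  limn (series (fun r : nat => (digit C n j r : nat)%:R / 2 ^+ r.+1 : R)).

Definition net_point (R : realType) (m d : nat)
    (C : 'I_d -> nat -> 'I_m -> 'F_2) (n : nat) : {ffun 'I_d -> R} :=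
  [ffun j => coordinate R C n j].

(* No digit sequence of the j-th coordinate ends in an infinite run of 1s, so
   that it is the binary expansion of the real number it defines.  Otherwise
   the first digits and the floor can disagree: 0.0111... (base 2) = 1/2. *)
Definition proper_expansions (m d : nat) (C : 'I_d -> nat -> 'I_m -> 'F_2)
    (j : 'I_d) : Prop :=
  forall n : 'I_(2 ^ m), forall k : nat,
    exists2 r : nat, (k <= r)%N & digit C n j r = 0.

Definition restrict (d : nat) (u : {set 'I_d}) (T : Type)
    (x : {ffun 'I_d -> T}) : {ffun {j : 'I_d | j \in u} -> T} :=
  [ffun j => x (val j)].

(* The points are indexed by 'I_(2 ^ m), hence counted with multiplicity. *)
Definition is_net (R : realType) (S : finType) (t m : nat)
    (P : 'I_(2 ^ m) -> {ffun S -> R}) : Prop :=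
  forall e b : S -> nat,
    (forall j, (b j < 2 ^ e j)%N) ->
    (\sum_(j : S) e j)%N = (m - t)%N ->
    #|[set n : 'I_(2 ^ m) | [forall j : S,
         (b j)%:R / 2 ^+ e j <= P n j < (b j).+1%:R / 2 ^+ e j]]| = (2 ^ t)%N.

Definition valid_t_value (R : realType) (m d : nat)
    (C : 'I_d -> nat -> 'I_m -> 'F_2) (u : {set 'I_d}) (t : nat) : Prop :=
  (t <= m)%N /\ is_net t (fun n : 'I_(2 ^ m) => restrict u (net_point R C n)).

Definition output_bits (m d : nat) (C : 'I_d -> nat -> 'I_m -> 'F_2)
    (p : nat) (u : {set 'I_d}) (v : 'cV['F_2]_m) :
    {ffun {j : 'I_d | j \in u} -> 'cV['F_2]_p} :=
  [ffun j => gen_block C p (val j) *m v].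

Lemma output_bits_is_linear (m d : nat) (C : 'I_d -> nat -> 'I_m -> 'F_2)
    (p : nat) (u : {set 'I_d}) : linear (@output_bits m d C p u).
Proof.
by move=> a v w; apply/ffunP => j; rewrite !ffunE mulmxDr scalemxAr.
Qed.

HB.instance Definition _ (m d : nat) (C : 'I_d -> nat -> 'I_m -> 'F_2)
    (p : nat) (u : {set 'I_d}) :=
  GRing.isLinear.Build 'F_2 'cV['F_2]_m
    {ffun {j : 'I_d | j \in u} -> 'cV['F_2]_p} _
    (@output_bits m d C p u) (@output_bits_is_linear m d C p u).

Definition Amap (m d : nat) (C : 'I_d -> nat -> 'I_m -> 'F_2)
    (p : nat) (u : {set 'I_d}) :
    'Hom('cV['F_2]_m, {ffun {j : 'I_d | j \in u} -> 'cV['F_2]_p}) :=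
  linfun (@output_bits m d C p u).

Definition lrank (K : fieldType) (U V : vectType K) (h : 'Hom(U, V)) : nat :=
  \dim (limg h).

(* Num.truncn is the floor, as a natural number, of a nonnegative real. *)
Definition symbol (R : realType) (p : nat) (x : R) : nat :=
  Num.truncn (2 ^+ p * x).

Definition transform (R : realType) (p : nat) (c : (2 ^ p).-tuple R)
    (d : nat) (x : {ffun 'I_d -> R}) : {ffun 'I_d -> R} :=
  [ffun j => c`_(symbol p (x j))].

Definition transformed_rule (R : realType) (m d : nat)
    (C : 'I_d -> nat -> 'I_m -> 'F_2) (p : nat) (c : (2 ^ p).-tuple R)
    (f : {ffun 'I_d -> R} -> R) : R :=
  (2 ^+ m)^-1 * \sum_(n < 2 ^ m) f (transform c (net_point R C n)).

Definition product_rule (R : realType) (d p : nat) (c : (2 ^ p).-tuple R)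
    (u : {set 'I_d}) (g : {ffun {j : 'I_d | j \in u} -> R} -> R) : R :=
  (2 ^+ (p * #|u|))^-1 *
  \sum_(a : {ffun {j : 'I_d | j \in u} -> 'I_(2 ^ p)})
     g [ffun j => tnth c (a j)].

(* f, a function on [0,1]^d, depends only on the coordinates in u, and g is f
   regarded as a function of those coordinates. *)
Definition depends_only_via (R : realType) (d : nat) (u : {set 'I_d})
    (f : {ffun 'I_d -> R} -> R)
    (g : {ffun {j : 'I_d | j \in u} -> R} -> R) : Prop :=
  forall x : {ffun 'I_d -> R},
    (forall j, 0 <= x j <= 1) -> f x = g (restrict u x).

(* Main.v *)
(** The points falling into a given dyadic cube of side 2^-p over the
    coordinates in u are counted by cutting the cube, along one coordinate, into
    2^(m - t - p|u|) elementary intervals of volume 2^(t-m).  Hence every one of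
    the 2^(p|u|) symbols is taken by exactly 2^(m - p|u|) points, which is the
    equality of the two cubature rules.  In particular every symbol is taken;
    when the digit sequences are proper binary expansions, the symbol of a point
    determines its leading p digits, so A_{p,u} is onto. *)

Require Import Defs.
From mathcomp Require Import all_boot all_order all_algebra.
From mathcomp Require Import all_classical all_reals all_analysis.
From mathcomp Require Import zify ring.
Import Order.TTheory GRing.Theory Num.Theory.
Import numFieldNormedType.Exports.
Local Open Scope ring_scope.

(** The integer whose binary digits, most significant first, are [y 0], ..., [y (p - 1)]. *)
Fixpoint head_value (y : nat -> nat) (p : nat) : nat :=
  if p is q.+1 then ((head_value y q).*2 + y q)%N else 0%N.

Lemma head_value_lt (y : nat -> nat) (p : nat) :
  (forall r, y r <= 1)%N -> (head_value y p < 2 ^ p)%N.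
Proof.
move=> y1; elim: p => //= p IH; have := y1 p.
rewrite expnS; move: (2 ^ p)%N IH => N; lia.
Qed.

(** The last digit is the parity of the value, so the digits can be peeled off from the end. *)
Lemma head_value_inj (y z : nat -> nat) (p : nat) :
  (forall r, y r <= 1)%N -> (forall r, z r <= 1)%N ->
  head_value y p = head_value z p -> forall r, (r < p)%N -> y r = z r.
Proof.
move=> y1 z1; elim: p => //= p IH E r.
have [yp zp] := (y1 p, z1 p).
have Ep : y p = z p by lia.
rewrite ltnS leq_eqVlt => /orP[/eqP->//|]; apply: IH; lia.
Qed.

Section Expansion.
Variables (R : realType) (y : nat -> nat).
Hypothesis y1 : forall r, (y r <= 1)%N.
Let u : R^nat := fun r => (y r)%:R / 2 ^+ r.+1.

Let pow2_gt0 q : 0 < 2 ^+ q :> R. Proof. by rewrite exprn_gt0. Qed.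

Lemma series_head_value p : series u p = (head_value y p)%:R / 2 ^+ p.
Proof.
elim: p => [|p IH]; first by rewrite seriesEnat /= big_geq // mul0r.
rewrite seriesSr IH /u /= natrD -mul2n natrM exprS.
have := pow2_gt0 p; move: (2 ^+ p) => N N0.
by field; rewrite gt_eqF.
Qed.

(** The value obtained when all digits from position [q] on are 1. It drops exactly at the digits
    0. *)
Let upper q : R := series u q + (2 ^+ q)^-1.

Let upperS q : upper q.+1 = upper q - (1 - (y q)%:R) / 2 ^+ q.+1.
Proof.
rewrite /upper seriesSr /u exprS.
have := pow2_gt0 q; move: (2 ^+ q) => N N0.
by field; rewrite gt_eqF.
Qed.

Let upper_nonincreasing q r : (q <= r)%N -> upper r <= upper q.
Proof.
elim: r => [|r IH]; first by rewrite leqn0 => /eqP->.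
rewrite leq_eqVlt => /orP[/eqP->//|/IH]; apply: le_trans.
by rewrite upperS gerBl divr_ge0 ?(ltW (pow2_gt0 _)) // subr_ge0 lern1.
Qed.

Let series_nondecreasing : {homo series u : n m / (n <= m)%N >-> n <= m}.
Proof.
by apply: nondecreasing_series => n _ _; rewrite divr_ge0 // ltW.
Qed.

Let series_le_upper q r : series u r <= upper q.
Proof.
apply: (@le_trans _ _ (series u (maxn q r))).
  by apply: series_nondecreasing; rewrite leq_maxr.
apply: le_trans (upper_nonincreasing _ _ (leq_maxl q r)).
by rewrite lerDl invr_ge0 ltW.
Qed.

Let series_cvg : cvgn (series u).
Proof.
apply: nondecreasing_is_cvgn => //.
by exists (upper 0) => _ [r _ <-]; exact: series_le_upper.
Qed.

(* A digit 0 at a position q >= p makes the upper bound on the tail strict. *)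
Lemma symbol_head_value p :
  (exists2 q, (p <= q)%N & y q = 0%N) ->
  symbol p (limn (series u)) = head_value y p.
Proof.
move=> [q pq yq0]; apply: truncn_def.
have lo := nondecreasing_cvgn_le series_nondecreasing series_cvg p.
have hi : limn (series u) < upper p.
  apply: lt_le_trans (upper_nonincreasing _ _ pq).
  apply: (@le_lt_trans _ _ (upper q.+1)).
    by apply: limr_le => //; apply: nearW => r; exact: series_le_upper.
  by rewrite upperS yq0 subr0 gtrBl divr_gt0.
move: lo hi; rewrite /upper series_head_value.
rewrite ler_pdivrMr // mulrC => -> /=.
by rewrite -{2}[(2 ^+ p)^-1]mul1r -mulrDl natr1 ltr_pdivlMr // mulrC.
Qed.

End Expansion.

Section Symbols.
Variable R : realType.
Implicit Type x : R.

(** A natural number is determined by the naturals below it, and [n] is at most either side exactly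
    when [n <= 2 ^+ p * x]. *)
Lemma symbol_div p s x : 0 <= x -> (symbol (p + s) x %/ 2 ^ s)%N = symbol p x.
Proof.
move=> x0.
have E n : (n <= symbol (p + s) x %/ 2 ^ s)%N = (n <= symbol p x)%N.
  rewrite leq_divRL ?expn_gt0 // !truncn_ge_nat ?mulr_ge0 ?exprn_ge0 //.
  by rewrite natrM natrX exprD mulrAC ler_pM2r ?exprn_gt0.
by apply/eqP; rewrite eqn_leq -E leqnn E leqnn.
Qed.

Lemma symbol_lt p x : 0 <= x < 1 -> (symbol p x < 2 ^ p)%N.
Proof.
move=> /andP[x0 x1]; rewrite truncn_lt_nat ?mulr_ge0 ?exprn_ge0 //.
by rewrite natrX gtr_pMr // exprn_gt0.
Qed.

Lemma symbol_eqE p b x : 0 <= x ->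
  (symbol p x == b) = (b%:R / 2 ^+ p <= x < b.+1%:R / 2 ^+ p).
Proof.
move=> x0; rewrite truncn_eq ?mulr_ge0 ?exprn_ge0 //.
by rewrite ler_pdivrMr ?exprn_gt0 // ltr_pdivlMr ?exprn_gt0 // mulrC.
Qed.

Lemma is_net_card_symbol (S : finType) (t m p : nat)
    (P : 'I_(2 ^ m) -> {ffun S -> R}) (a : S -> nat) :
  is_net t P -> (forall n j, 0 <= P n j < 1) -> (t <= m)%N ->
  (p * #|S| <= m - t)%N -> (forall j, a j < 2 ^ p)%N ->
  #|[set n | [forall j, symbol p (P n j) == a j]]| = (2 ^ (m - p * #|S|))%N.
Proof.
move=> net P01 tm pS a_lt.
have P0 n j : 0 <= P n j by case/andP: (P01 n j).
(* Without coordinates there is no direction to cut along; the condition is void and all [2 ^ m]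
   points count. *)
case: (pickP (mem [set: S])) => [j0 _|S0]; last first.
  have -> : #|S| = 0%N by apply: eq_card0 => j; have := S0 j; rewrite !inE.
  rewrite muln0 subn0 -[RHS]card_ord; apply: eq_card => n; rewrite !inE.
  by apply/forallP => j; have := S0 j; rewrite !inE.
(* Refining [j0] by [s] further bits brings the sum of the exponents to exactly [m - t]. *)
pose s := (m - t - p * #|S|)%N.
pose e j := (p + (if j == j0 then s else 0))%N.
have sum_e : (\sum_j e j = m - t)%N.
  rewrite big_split /= sum_nat_const -big_mkcond big_pred1_eq /s.
  by rewrite mulnC subnKC.
(* The [s] extra bits along [j0] tell in which slice of the cube a point lies. *)
pose cut n : 'I_(2 ^ s) :=
  Ordinal (ltn_pmod (symbol (p + s) (P n j0)) (expn_gt0 2 s)).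
have card_cut k : #|[set n | [forall j, symbol p (P n j) == a j] &
                       (cut n == k)]| = (2 ^ t)%N.
  (* Along [j0] the bits of [a j0] are followed by the [s] bits of [k]. *)
  pose b j := if j == j0 then (a j * 2 ^ s + k)%N else a j.
  have b_lt j : (b j < 2 ^ e j)%N.
    rewrite /b /e; case: eqP => _; last by rewrite addn0.
    rewrite expnD -ltn_divLR ?expn_gt0 // divnMDl ?expn_gt0 //.
    by rewrite divn_small // addn0.
  rewrite -(net e b b_lt sum_e); apply: eq_card => n; rewrite !inE.
  have E : [forall j, (b j)%:R / 2 ^+ e j <= P n j < (b j).+1%:R / 2 ^+ e j]
         = [forall j, symbol (e j) (P n j) == b j].
    by apply: eq_forallb => j; rewrite symbol_eqE.
  have refine j : symbol (p + s) (P n j) =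
      (symbol p (P n j) * 2 ^ s + symbol (p + s) (P n j) %% 2 ^ s)%N.
    by rewrite -(symbol_div p s) // -divn_eq.
  rewrite E; apply/andP/forallP => [[/forallP sa /eqP cutk] j|sb].
    rewrite /b /e; case: (j =P j0) => [->|_]; last by rewrite addn0.
    by rewrite refine (eqP (sa j0)) -cutk.
  have sb0 : symbol (p + s) (P n j0) = (a j0 * 2 ^ s + k)%N.
    by have := eqP (sb j0); rewrite /e /b eqxx.
  split; last by rewrite -val_eqE /= sb0 modnMDl modn_small.
  apply/forallP => j; have [->|jj0] := eqVneq j j0.
    rewrite -(symbol_div p s) // sb0 divnMDl ?expn_gt0 //.
    by rewrite divn_small // addn0.
  by have := sb j; rewrite /e /b (negbTE jj0) addn0.
(* Summing over the [2 ^ s] slices of [2 ^ t] points each gives the count, as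
   [s + t = m - p * #|S|]. *)
rewrite -sum1_card (partition_big cut xpredT) //=.
rewrite (eq_bigr (fun=> 2 ^ t)%N) => [|k _]; last first.
  by rewrite -(card_cut k) -sum1_card; apply: eq_bigl => n; rewrite !inE.
rewrite sum_nat_const card_ord -expnD /s; congr (2 ^ _)%N.
by move: pS; move: (p * #|S|)%N => q; lia.
Qed.

End Symbols.

Lemma dim_ffun (K : fieldType) (I : finType) (V : vectType K) :
  dim {ffun I -> V} = (#|I| * dim V)%N.
Proof. by []. Qed.

(** A series of digits can sum to 1, so [hC] states that the points lie in the half-open cube.
    Properness is assumed where matrix digits are read off from real coordinates, namely for the
    rank. *)
Theorem proposition3p2 (R : realType) (m d : nat)
    (C : 'I_d -> nat -> 'I_m -> 'F_2)
    (hC : forall (n : 'I_(2 ^ m)) (j : 'I_d), 0 <= net_point R C n j < 1)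
    (p : nat) (hp : (1 <= p)%N)
    (c : (2 ^ p).-tuple R) (hc : forall a, 0 <= tnth c a <= 1)
    (u : {set 'I_d}) (t : nat) (ht : valid_t_value R C u t)
    (hpu : (p * #|u| <= m - t)%N) :
  ((forall j, j \in u -> proper_expansions C j) ->
     lrank (Amap C p u) = (p * #|u|)%N) /\
  (forall (f : {ffun 'I_d -> R} -> R)
          (g : {ffun {j : 'I_d | j \in u} -> R} -> R),
     depends_only_via f g ->
     transformed_rule C c f = product_rule c g).
Proof.
have [tm net] := ht.
have card_u : #|{: {j : 'I_d | j \in u}}| = #|u| by rewrite card_sig.
have card_symbol (a : {j : 'I_d | j \in u} -> nat) :
    (forall j, a j < 2 ^ p)%N ->
    #|[set n : 'I_(2 ^ m) |
        [forall j, symbol p (net_point R C n (val j)) == a j]]|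
      = (2 ^ (m - p * #|u|))%N.
  move=> a_lt; rewrite -card_u.
  rewrite -(is_net_card_symbol _ _ _ _ _ _ a net _ tm _ a_lt) ?card_u //.
    apply: eq_card => n; rewrite !inE.
    by apply: eq_forallb => j; rewrite !ffunE.
  by move=> n j; rewrite ffunE.
split=> [proper|f g fg].
  have F2_le1 (z : 'F_2) : (z <= 1)%N by rewrite -ltnS; case: z.
  (* The target has dimension [p * #|u|], so the rank claim is surjectivity. *)
  suff full : limg (Amap C p u) = fullv.
    by rewrite /lrank full dimvf dim_ffun dim_matrix card_u mulr1 mulnC.
  apply/vspaceP => w; rewrite memvf.
  (* [head_value] reads sequences indexed by [nat], so the digits of [w] are padded by 0 from row
     [p] on. *)
  have [w' w'E] : exists w' : {j : 'I_d | j \in u} -> nat -> 'F_2,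
      forall j (r : 'I_p), w' j r = w j r 0.
    exists (fun j r => if insub r is Some i then w j i 0 else 0) => j r.
    by rewrite valK.
  have a_lt j : (head_value (fun r => w' j r : nat) p < 2 ^ p)%N.
    exact: head_value_lt.
  (* Some point has the symbols spelled by [w]; the bits of its index form a preimage of [w]. *)
  have /card_gt0P[n] : (0 < #|[set n : 'I_(2 ^ m) | [forall j,
      symbol p (net_point R C n (val j)) ==
        head_value (fun r => w' j r : nat) p]]|)%N.
    by rewrite card_symbol // expn_gt0.
  rewrite inE => /forallP hn.
  suff -> : w = Amap C p u (bits m n) by rewrite memv_img ?memvf.
  rewrite lfunE /=; apply/ffunP => j; rewrite ffunE; apply/matrixP => r k.
  rewrite ord1 -w'E mxE.
  transitivity (digit C n (val j) r); last first.
    by apply: eq_bigr => i _; rewrite !mxE.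
  apply/val_inj; symmetry.
  apply: (head_value_inj (fun r => digit C n (val j) r : nat)
                          (fun r => w' j r : nat) p) => //.
  rewrite -(eqP (hn j)) ffunE symbol_head_value //.
  have [q pq yq] := proper _ (valP j) n p.
  by exists q => //; rewrite yq.
pose sy (n : 'I_(2 ^ m)) : {ffun {j : 'I_d | j \in u} -> 'I_(2 ^ p)} :=
  [ffun j => Ordinal (symbol_lt _ p _ (hC n (val j)))].
rewrite /transformed_rule /product_rule.
have fE (n : 'I_(2 ^ m)) :
    f (transform c (net_point R C n)) = g [ffun j => tnth c (sy n j)].
  rewrite fg => [|j].
    congr g; apply/ffunP => j; rewrite !ffunE.
    by rewrite (tnth_nth 0) /= ffunE.
  (* [fg] applies on the closed unit cube, where the nodes lie by [hc]. *)
  rewrite ffunE; have := hc (Ordinal (symbol_lt _ p _ (hC n j))).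
  by rewrite (tnth_nth 0).
(* Grouped by symbol vector, each node is hit [2 ^ (m - p * #|u|)] times, which turns the weight
   [2 ^ -m] into [2 ^ -(p * #|u|)]. *)
rewrite (eq_bigr _ (fun n _ => fE n)) (partition_big sy xpredT) //.
rewrite (eq_bigr (fun a : {ffun {j : 'I_d | j \in u} -> 'I_(2 ^ p)} =>
  2 ^+ (m - p * #|u|) * g [ffun j => tnth c (a j)])).
  rewrite -mulr_sumr mulrA; congr (_ * _).
  have pm : (p * #|u| <= m)%N by apply: leq_trans hpu (leq_subr _ _).
  by rewrite -{1}(subnK pm) exprD invfM mulrAC mulVf ?mul1r.
move=> a _.
rewrite (eq_bigr (fun=> g [ffun j => tnth c (a j)])) => [|n /eqP-> //].
rewrite sumr_const -[LHS]mulr_natl -natrX; congr (_%:R * _).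
rewrite -(card_symbol (fun j => a j : nat)) //.
apply: eq_card => n; rewrite [RHS]inE -[LHS]/(sy n == a).
apply/eqP/forallP => [<- j|E]; first by rewrite !ffunE /= ffunE.
by apply/ffunP => j; apply/val_inj; rewrite /= -(eqP (E j)) !ffunE /= ffunE.
Qed.
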